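(* Let $\mathcal V$ be an algebra of differentiable functions and $A=\bigoplus_{i\in I}\mathbb F[\partial]u_i$ with zero $\lambda$-bracket acting on $\mathcal V$ by ${u_i}_\lambda f=\sum_n\lambda^n\frac{\partial f}{\partial u_i^{(n)}}$. Define $\Phi^\bullet:\tilde\Gamma^\bullet(A,\mathcal V)\to\tilde\Omega^\bullet(\mathcal V)$ by $\Phi^0=\mathrm{id}_{\mathcal V}$ and, for $k\ge1$, $\Phi^k(\tilde\gamma)=\frac1{k!}\sum_{i_r\in I,m_r\in\mathbb Z_+}f^{m_1\cdots m_k}_{i_1\cdots i_k}\,\delta u_{i_1}^{(m_1)}\wedge\cdots\wedge\delta u_{i_k}^{(m_k)}$, where $f^{m_1\cdots m_k}_{i_1\cdots i_k}$ is the coefficient of $\lambda_1^{m_1}\cdots\lambda_k^{m_k}$ in $\tilde\gamma_{\lambda_1,\dots,\lambda_k}(u_{i_1},\dots,u_{i_k})$. Then $\Phi^\bullet$ is a bijective superalgebra isomorphism (for the exterior products) satisfying $\Phi\circ\delta=\delta\circ\Phi$ and $\Phi\circ\iota_\xi=\iota_{\Phi_1(\xi)}\circ\Phi$ for all $\xi\in\tilde\Gamma_1$; hence it is an isomorphism of $\mathfrak g$-complexes (identifying $\Pi\tilde\Gamma_1$ with $\mathfrak g$ via $\Phi_1$). Moreover $\Phi^\bullet\circ\partial=\partial\circ\Phi^\bullet$, so it induces an isomorphism of reduced $\mathfrak g^\partial$-complexes $\Gamma^\bullet(A,\mathcal V)\simeq\Omega^\bullet(\mathcal V)$.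
   Context: $\mathbb F$ field of characteristic 0, $I=\{1,\dots,\ell\}$ finite. Algebra of differentiable functions $\mathcal V$: unital commutative associative with derivation $\partial$ and commuting derivations $\frac{\partial}{\partial u_i^{(n)}}$, finitely many nonzero on each element, $[\frac{\partial}{\partial u_i^{(n)}},\partial]=\frac{\partial}{\partial u_i^{(n-1)}}$. $\mathfrak g$ = vector fields $\sum P_{i,n}\frac{\partial}{\partial u_i^{(n)}}$, $\mathfrak g^\partial$ those commuting with $\partial$. $\tilde\Gamma^k(A,\mathcal V)$: $\mathbb F$-linear $\tilde\gamma:A^{\otimes k}\to\mathbb F[\lambda_1..\lambda_k]\otimes\mathcal V$ with $\tilde\gamma(..,\partial a_i,..)=-\lambda_i\tilde\gamma$ and skew-symmetric under simultaneous permutation of $a_i,\lambda_i$; here $(\delta\tilde\gamma)_{\lambda_1..\lambda_{k+1}}(a_1..a_{k+1})=\sum_i(-1)^{i+1}{a_i}_{\lambda_i}\tilde\gamma_{\lambda_1\overset{i}{\check\cdots}\lambda_{k+1}}(a_1\overset{i}{\check\cdots}a_{k+1})$; $(\partial\tilde\gamma)_{\lambda_1..\lambda_k}=(\partial+\lambda_1+\dots+\lambda_k)\tilde\gamma_{\lambda_1..\lambda_k}$; wedge product $(\tilde\alpha\wedge\tilde\beta)=\sum_{\sigma\in S_{h+k}}\frac{\mathrm{sign}\sigma}{h!k!}\tilde\alpha_{\lambda_{\sigma(1)}..}(a_{\sigma(1)}..)\tilde\beta_{..\lambda_{\sigma(h+k)}}(..a_{\sigma(h+k)})$; $\Gamma^\bullet=\tilde\Gamma^\bullet/\partial\tilde\Gamma^\bullet$.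 $\tilde\Gamma_1=(A\otimes\mathcal V[[x]])/(\partial\otimes1+1\otimes\partial_x)(\cdots)$, each element uniquely $\xi=\sum_iu_i\otimes P_i(x)$, $P_i(x)=\sum_n\frac1{n!}P_{i,n}x^n$; contraction $(\iota_\xi\tilde\gamma)_{\lambda_2..\lambda_k}(a_2..a_k)=\sum_i\langle P_i(x_1),\tilde\gamma_{\lambda_1,..,\lambda_k}(u_i,a_2,..,a_k)\rangle$ with $\langle x^m,\lambda^n\rangle=n!\delta_{mn}$ followed by multiplication in $\mathcal V$; $\Phi_1(\xi)=\sum_{i,n}P_{i,n}\frac{\partial}{\partial u_i^{(n)}}$, a Lie algebra isomorphism $\Pi\tilde\Gamma_1\to\mathfrak g$ for the bracket $[u_i\otimes P(x),u_j\otimes Q(x)]=-u_i\otimes\sum_nQ_n\frac{\partial P(x)}{\partial u_j^{(n)}}+u_j\otimes\sum_mP_m\frac{\partial Q(x)}{\partial u_i^{(m)}}$. A $\mathfrak g$-complex structure means the $\mathbb Z$-graded Lie superalgebra homomorphism from $\eta\mathfrak g\oplus\mathfrak g\oplus\mathbb F\partial_\eta$ given by $\partial_\eta\mapsto\delta$, $\eta X\mapsto\iota_X$, $X\mapsto L_X=\delta\iota_X+\iota_X\delta$. $\tilde\Omega^\bullet$: free supercommutative $\mathcal V$-algebra on odd degree-1 generators $\delta u_i^{(n)}$; $\delta$ odd derivation with $\delta f=\sum\frac{\partial f}{\partial u_i^{(n)}}\delta u_i^{(n)}$, $\delta(\delta u_i^{(n)})=0$; for $X=\sum P_{i,n}\frac{\partial}{\partial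 u_i^{(n)}}$, $\iota_X$ odd derivation of degree $-1$ with $\iota_X(f)=0$, $\iota_X(\delta u_i^{(n)})=P_{i,n}$; $\partial$ even derivation extending $\partial$ with $\partial(\delta u_i^{(n)})=\delta u_i^{(n+1)}$; $\Omega^\bullet=\tilde\Omega^\bullet/\partial\tilde\Omega^\bullet$. *)

(* Defs.v *)
From HB Require Import structures.
From mathcomp Require Import all_boot all_order all_algebra all_fingroup.
From mathcomp Require Import mpoly.
From Stdlib Require Import ClassicalEpsilon.

Set Implicit Arguments.
Unset Strict Implicit.
Unset Printing Implicit Defensive.

Import GRing.Theory.
Local Open Scope ring_scope.

(* Sum of a finitely supported family indexed by nat (Z_+): sum up to any   *)
(* bound beyond which the family vanishes (chosen by Hilbert's epsilon; the *)
(* value does not depend on the choice when such a bound exists).           *)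
Definition fsum (M : nmodType) (f : nat -> M) : M :=
  let N := epsilon (inhabits 0%N) (fun N => forall n, (N <= n)%N -> f n = 0) in
  \sum_(n < N) f n.

Definition upd (T : Type) k (a : {ffun 'I_k -> T}) (r : 'I_k) (x : T)
  : {ffun 'I_k -> T} := [ffun j => if j == r then x else a j].
Definition consf (T : Type) k (x : T) (a : {ffun 'I_k -> T})
  : {ffun 'I_k.+1 -> T} :=
  [ffun j => if unlift ord0 j is Some j' then a j' else x].
Definition mtail k (m : 'X_{1..k.+1}) : 'X_{1..k} :=
  [multinom m (lift ord0 j) | j < k].

Section DiffAlg.
Variables (F : fieldType) (l : nat) (V : comAlgType F).

Definition is_Fderivation (D : V -> V) : Prop :=
  [/\ forall f g, D (f + g) = D f + D g,
      forall (c : F) f, D (c *: f) = c *: D f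
    & forall f g, D (f * g) = D f * g + f * D g].

(* V is an algebra of differentiable functions, with total derivative d and *)
(* partial derivatives pd i n = d/du_i^{(n)}, i in I = 'I_l, n in Z_+.      *)
Definition diff_alg (d : V -> V) (pd : 'I_l -> nat -> V -> V) : Prop :=
  [/\ is_Fderivation d /\ forall i n, is_Fderivation (pd i n),
      forall i n j m f, pd i n (pd j m f) = pd j m (pd i n f),
      (* [d/du_i^{(n)}, d] = d/du_i^{(n-1)}, with d/du_i^{(-1)} = 0 *)
      forall i n f, pd i n.+1 (d f) - d (pd i n.+1 f) = pd i n f,
      forall i f, pd i 0 (d f) - d (pd i 0 f) = 0
    &
      forall f, exists N, forall i n, (N <= n)%N -> pd i n f = 0].

(* The Lie conformal algebra A = (+)_{i in I} F[d] u_i (zero lambda-bracket): *)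
(* a row vector of polynomials in d; u_i = i-th basis vector; d acts by 'X.  *)
Definition LCA := 'rV[{poly F}]_l.
Definition uA (i : 'I_l) : LCA := delta_mx 0 i.
Definition dA (a : LCA) : LCA := 'X *: a.

Definition coefmap k (D : V -> V) (P : {mpoly V[k]}) : {mpoly V[k]} :=
  \sum_(m <- msupp P) D P@_m *: 'X_[m].

(* the A-module structure on V: (p(d)u_i)_{lambda} f =                      *)
(*   p(-lambda) sum_n lambda^n df/du_i^{(n)}, where lambda = lambda_r and    *)
(*   the action is extended coefficientwise to F[lambda_1..](x)V            *)
Definition actA (pd : 'I_l -> nat -> V -> V) k (a : LCA) (r : 'I_k)
    (P : {mpoly V[k]}) : {mpoly V[k]} :=
  \sum_(i < l)
    (map_poly (fun c : F => (c%:A : V)%:MP_[k]) (a 0 i)).[- 'X_r]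
    * fsum (fun n => 'X_r ^+ n * coefmap (pd i n) P).

(* An F-linear map A^{(x)k} -> F[lambda_1..lambda_k](x)V is given by an      *)
(* F-multilinear map on k-tuples of elements of A.                          *)
Definition GammaT k := {ffun 'I_k -> LCA} -> {mpoly V[k]}.

Definition isGamma k (g : GammaT k) : Prop :=
  [/\
      forall a r x y, g (upd a r (x + y)) = g (upd a r x) + g (upd a r y),
      forall a r (c : F) x, g (upd a r (c%:P *: x)) = (c%:A : V) *: g (upd a r x),
      forall a r, g (upd a r (dA (a r))) = - ('X_r * g a)
    &
      forall (s : 'S_k) (a : {ffun 'I_k -> LCA}),
        comp_mpoly [tuple 'X_(s j) | j < k] (g [ffun j => a (s j)])
        = ((-1) ^+ odd_perm s : V) *: g a].

Definition deltaG (pd : 'I_l -> nat -> V -> V) k (g : GammaT k) : GammaT k.+1 :=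
  fun a => \sum_(r < k.+1) ((-1) ^+ r : V) *:
     actA pd (a r) r
       (comp_mpoly [tuple 'X_(lift r j) | j < k] (g [ffun j => a (lift r j)])).

Definition partialG (d : V -> V) k (g : GammaT k) : GammaT k :=
  fun a => coefmap d (g a) + (\sum_(j < k) 'X_j) * g a.

Definition wedgeG h k (al : GammaT h) (be : GammaT k) : GammaT (h + k) :=
  fun a => ((h`! * k`!)%:R^-1 : F)%:A *:
    \sum_(s : 'S_(h + k)) ((-1) ^+ odd_perm s : V) *:
      (comp_mpoly [tuple 'X_(s (lshift k j)) | j < h]
                  (al [ffun j => a (s (lshift k j))])
     * comp_mpoly [tuple 'X_(s (rshift h j)) | j < k]
                  (be [ffun j => a (s (rshift h j))])).

(* An element xi = sum_i u_i (x) P_i(x) of tilde Gamma_1, with              *)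
(* P_i(x) = sum_n (1/n!) P_{i,n} x^n, is given by the family P_{i,n}; its   *)
(* image Phi_1(xi) is the vector field sum P_{i,n} d/du_i^{(n)}.            *)
(* Contraction: pairing <x^m, lambda_1^n> = n! delta_{mn}, then product.    *)
Definition iotaG (P : 'I_l -> nat -> V) k (g : GammaT k.+1) : GammaT k :=
  fun a => \sum_(i < l)
    \sum_(m <- msupp (g (consf (uA i) a)))
      ((((m ord0)`!%:R : F)^-1 *: P i (m ord0))
        * (((m ord0)`!)%:R * (g (consf (uA i) a))@_m)) *: 'X_[mtail m].

(* tilde Omega^k(V): the degree-k part of the free supercommutative         *)
(* V-algebra on odd generators du_i^{(n)}, realized as finitely supported   *)
(* skew-symmetric coefficient functions w on k-tuples of generators, w      *)
(* standing for (1/k!) sum_g w(g) du_{g_1}/\.../\du_{g_k}.                   *)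
Definition Gen := ('I_l * nat)%type.
Definition OmegaT k := {ffun 'I_k -> Gen} -> V.

Definition isOmega k (w : OmegaT k) : Prop :=
  (forall (s : 'S_k) (g : {ffun 'I_k -> Gen}), w [ffun j => g (s j)] = (-1) ^+ odd_perm s * w g)
  /\ (exists N, forall (g : {ffun 'I_k -> Gen}) (j : 'I_k), (N <= (g j).2)%N -> w g = 0).

Definition genO (x : Gen) : OmegaT 1 := fun g => if g ord0 == x then 1 else 0.

Definition wedgeO h k (al : OmegaT h) (be : OmegaT k) : OmegaT (h + k) :=
  fun g => ((h`! * k`!)%:R^-1 : F)%:A *
    \sum_(s : 'S_(h + k)) (-1) ^+ odd_perm s *
       al [ffun j => g (s (lshift k j))] * be [ffun j => g (s (rshift h j))].

Fixpoint wedgeseq k : {ffun 'I_k -> Gen} -> OmegaT k :=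
  match k with
  | 0 => fun _ _ => 1
  | k'.+1 => fun x => wedgeO (genO (x ord0)) (wedgeseq [ffun j => x (lift ord0 j)])
  end.

(* delta: the odd derivation with delta f = sum df/du_i^{(n)} du_i^{(n)}    *)
(* and delta(du_i^{(n)}) = 0, in coefficient form                           *)
Definition deltaO (pd : 'I_l -> nat -> V -> V) k (w : OmegaT k) : OmegaT k.+1 :=
  fun g => \sum_(r < k.+1)
     (-1) ^+ r * pd (g r).1 (g r).2 (w [ffun j => g (lift r j)]).

(* d: the even derivation extending d with d(du_i^{(n)}) = du_i^{(n+1)}      *)
Definition partialO (d : V -> V) k (w : OmegaT k) : OmegaT k :=
  fun g => d (w g) + \sum_(j < k)
     (if (g j).2 is n.+1 then w (upd g j ((g j).1, n)) else 0).

(* iota_X for X = sum P_{i,n} d/du_i^{(n)}: odd derivation of degree -1     *)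
(* with iota_X f = 0, iota_X(du_i^{(n)}) = P_{i,n}                           *)
Definition iotaO (P : 'I_l -> nat -> V) k (w : OmegaT k.+1) : OmegaT k :=
  fun g => \sum_(i < l) fsum (fun n => P i n * w (consf (i, n) g)).

Definition Phi k (g : GammaT k) : OmegaT k :=
  fun x => ((k`!%:R : F)^-1)%:A *
    \sum_(i : {ffun 'I_k -> 'I_l})
      \sum_(m <- msupp (g [ffun j => uA (i j)]))
        (g [ffun j => uA (i j)])@_m * wedgeseq [ffun j => (i j, m j)] x.

End DiffAlg.

(* Main.v *)
Require Import Defs.
From HB Require Import structures.
From mathcomp Require Import all_boot all_order all_algebra all_fingroup.
From mathcomp Require Import mpoly.
From Stdlib Require Import ClassicalEpsilon FunctionalExtensionality.
Import GRing.Theory.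
Local Open Scope ring_scope.

(* By sesquilinearity a cochain is determined by its values on the           *)
(* generators u_i, i.e. by the family coefG g of coefficients of             *)
(* lambda^m in g(u_{i_1}, .., u_{i_k}), and its skew-symmetry says that this *)
(* family is an alternating function of the pairs (i_r, m_r).  A product of  *)
(* generators du_y has the coefficient function                              *)
(* x |-> sum_s sign(s) [x o s = y], so Phi g antisymmetrizes coefG g; the    *)
(* factor 1/k! makes Phi g = coefG g.  Every compatibility is then an        *)
(* identity between coefficients of polynomials in lambda, and the inverse   *)
(* of Phi is the sesquilinear extension of the values on the generators.     *)

Set Implicit Arguments.
Unset Strict Implicit.
Unset Printing Implicit Defensive.

(** [wedgeseqE] expands products of generators, so [Phi g] is the antisymmetrization of the table
    [coefG g], and [PhiE] cancels 1/k! against k! equal terms when that table alternates. From then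
    on [Phi] just reads off coefficients. [coefG_wedge], [coefG_delta], [coefG_partial] and
    [coefG_iota] match each operation on cochains with its counterpart on forms, one coefficient at
    a time. Their common tool is [mcoeff_shuffle]: substitution into complementary sets of variables
    splits every exponent vector in two. Injectivity is [eq_from_coefG], since the u_i generate A
    over F[d]; surjectivity comes from [cochain_of], whose table is the given form. As [Phi] is
    bijective and commutes with d, it matches the images of d on both sides, which gives the
    statement on quotients. *)

Lemma fsumE (M : nmodType) (f : nat -> M) N :
  (forall n, (N <= n)%N -> f n = 0) -> fsum f = \sum_(n < N) f n.
Proof.
have widen N1 N2 : (N1 <= N2)%N -> (forall n, (N1 <= n)%N -> f n = 0) ->
    \sum_(n < N1) f n = \sum_(n < N2) f n.
  move=> le12 f0; rewrite (big_ord_widen _ f le12) big_mkcond.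
  by apply: eq_bigr => i _; case: ltnP => // /f0.
move=> f0; rewrite /fsum.
have := epsilon_spec (inhabits 0%N)
  (fun N => forall n, (N <= n)%N -> f n = 0) (ex_intro _ N f0).
set N0 := epsilon _ _ => f0'.
rewrite (widen _ (maxn N0 N)) ?leq_maxl //.
by rewrite (widen N (maxn N0 N)) ?leq_maxr.
Qed.

(** * Coefficients of polynomials after a renaming of variables *)

Section Monomials.
Variable R : comNzRingType.

Definition pullm h n (f : 'I_h -> 'I_n) (m : 'X_{1..n}) : 'X_{1..h} :=
  [multinom m (f j) | j < h].

Lemma sum_msuppE n (P : {mpoly R[n]}) (Z : 'X_{1..n} -> R) m :
  (forall m', Z m' = (m' == m)%:R) ->
  \sum_(m' <- msupp P) P@_m' * Z m' = P@_m.
Proof.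
move=> ZE; rewrite [in RHS](mpolyE P) raddf_sum /=.
by apply: eq_bigr => m' _; rewrite mcoeffZ mcoeffX ZE.
Qed.

Lemma comp_mpolyX_vars h n (f : 'I_h -> 'I_n) p :
  comp_mpoly [tuple 'X_(f j) | j < h] ('X_[p] : {mpoly R[h]})
  = 'X_[\sum_(j < h) U_(f j) *+ p j].
Proof.
rewrite comp_mpolyX -mprodXE; apply: eq_bigr => j _.
by rewrite tnth_mktuple mpolyXn.
Qed.

(** The images of [f] and [g] partition the variables, so a monomial m arises from exactly one pair
    of monomials, its restrictions to the two blocks. Permutations, insertion of a variable and the
    terms of a wedge product are all instances. *)
Lemma mcoeff_shuffle h k n (f : 'I_h -> 'I_n) (g : 'I_k -> 'I_n)
    (P : {mpoly R[h]}) (Q : {mpoly R[k]}) m :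
  injective f -> injective g -> (forall i j, f i != g j) ->
  (forall x, (exists i, f i = x) \/ (exists j, g j = x)) ->
  (comp_mpoly [tuple 'X_(f j) | j < h] P
     * comp_mpoly [tuple 'X_(g j) | j < k] Q)@_m
  = P@_(pullm f m) * Q@_(pullm g m).
Proof.
move=> f_inj g_inj fg cover.
have pushE a (e : 'I_a -> 'I_n) (p : 'X_{1..a}) i :
    (\sum_(j < a) U_(e j) *+ p j)%MM i = (\sum_(j < a | e j == i) p j)%N.
  rewrite mnm_sumE [RHS]big_mkcond; apply: eq_bigr => j _.
  by rewrite mulmnE mnm1E; case: eqP => _; rewrite ?mul1n ?mul0n.
have push_id a (e : 'I_a -> 'I_n) (p : 'X_{1..a}) i : injective e ->
    (\sum_(j < a) U_(e j) *+ p j)%MM (e i) = p i.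
  move=> e_inj; rewrite pushE (eq_bigl (pred1 i)) ?big_pred1_eq // => j.
  by rewrite (inj_eq e_inj).
have push_fg (p : 'X_{1..h}) i : (\sum_(j < h) U_(f j) *+ p j)%MM (g i) = 0%N.
  by rewrite pushE big_pred0 // => j; apply: negbTE.
have push_gf (p : 'X_{1..k}) i : (\sum_(j < k) U_(g j) *+ p j)%MM (f i) = 0%N.
  by rewrite pushE big_pred0 // => j; apply: negbTE; rewrite eq_sym.
have monE (p : 'X_{1..h}) (q : 'X_{1..k}) : ('X_[\sum_(j < h) U_(f j) *+ p j]
      * 'X_[\sum_(j < k) U_(g j) *+ q j] : {mpoly R[n]})@_m
    = (p == pullm f m)%:R * (q == pullm g m)%:R.
  rewrite -mpolyXD mcoeffX -natrM mulnb; congr (nat_of_bool _)%:R.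
  apply/eqP/andP => [<-|[/eqP-> /eqP->]].
    split; apply/eqP/mnmP => i; rewrite mnmE mnmDE push_id //.
      by rewrite push_gf addn0.
    by rewrite push_fg.
  apply/mnmP => x; rewrite mnmDE.
  case: (cover x) => [] [i <-]; rewrite push_id // mnmE.
    by rewrite push_gf addn0.
  by rewrite push_fg.
rewrite {1}(mpolyE P) {1}(mpolyE Q) !raddf_sum /= mulr_suml raddf_sum /=.
rewrite -(@sum_msuppE _ P (fun p => (p == pullm f m)%:R) (pullm f m)) // mulr_suml.
apply: eq_bigr => p _; rewrite mulr_sumr raddf_sum /=.
rewrite -(@sum_msuppE _ Q (fun q => (q == pullm g m)%:R) (pullm g m)) // mulr_sumr.
apply: eq_bigr => q _; rewrite !comp_mpolyZ !comp_mpolyX_vars.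
by rewrite -scalerAl -scalerAr !mcoeffZ monE mulrA mulrACA.
Qed.

Lemma mcoeff_perm n (s : 'S_n) (P : {mpoly R[n]}) m :
  (comp_mpoly [tuple 'X_(s j) | j < n] P)@_m = P@_(pullm s m).
Proof.
(* The second block is empty: [no0] provides the map out of 'I_0, and the second factor is the
   constant 1. *)
have no0 : 'I_0 -> False by case.
have := @mcoeff_shuffle n 0 n s (fun j => match no0 j with end) P 1 m.
rewrite comp_mpoly1 !mulr1 => ->.
- by rewrite mcoeff1 (_ : _ == _) ?mulr1 //; apply/eqP/mnmP; case.
- exact: perm_inj.
- by case.
- by move=> ?; case.
- by move=> x; left; exists (s^-1 x)%g; rewrite permKV.
Qed.

Lemma mcoeff_lift n (r : 'I_n.+1) e (P : {mpoly R[n]}) m :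
  ('X_r ^+ e * comp_mpoly [tuple 'X_(lift r j) | j < n] P)@_m
  = (e == m r)%:R * P@_(pullm (lift r) m).
Proof.
have := @mcoeff_shuffle n 1 n.+1 (lift r) (fun => r) P ('X_ord0 ^+ e) m.
rewrite rmorphXn /= comp_mpolyXU -tnth_nth tnth_mktuple mulrC => ->.
- rewrite mulrC mcoeffXn; congr ((nat_of_bool _)%:R * _).
  apply/eqP/eqP => [/mnmP/(_ ord0)|->].
    by rewrite mnmE mulmnE mnm1E mul1n.
  by apply/mnmP => j; rewrite (ord1 j) mnmE mulmnE mnm1E eqxx mul1n.
- exact: lift_inj.
- by move=> i j _; rewrite (ord1 i) (ord1 j).
- by move=> i _; rewrite eq_sym neq_lift.
- by move=> x; case: (unliftP r x) => [j|] ->; [left; exists j|right; exists ord0].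
Qed.

Lemma mcoeff_XU n (i : 'I_n) (P : {mpoly R[n]}) m :
  ('X_i * P)@_m = if (m i == 0)%N then 0 else P@_(m - U_(i)).
Proof.
rewrite mulrC; case: ifPn => [m0|mn0].
  rewrite (mpolyE P) mulr_suml raddf_sum big1 //= => p _.
  rewrite -scalerAl -mpolyXD mcoeffZ mcoeffX.
  case: eqP => [E|_]; last by rewrite mulr0.
  by move: m0; rewrite -E mnmDE mnm1E eqxx addn1.
have {1}-> : m = (U_(i) + (m - U_(i)))%MM by rewrite addmC submK // lep1mP.
by rewrite mcoeffMX.
Qed.

End Monomials.

(** * [Phi] as the table of coefficients on generators *)

Section PhiCoefficients.
Variables (F : fieldType) (l : nat) (V : comAlgType F).
Hypothesis charF : [pchar F] =i pred0.

Definition alternating k (w : OmegaT l V k) : Prop :=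
  forall (s : 'S_k) (x : {ffun 'I_k -> Gen l}),
    w [ffun j => x (s j)] = (-1) ^+ odd_perm s * w x.

Definition coefG k (g : GammaT l V k) : OmegaT l V k :=
  fun x => (g [ffun j => uA F (x j).1])@_[multinom (x j).2 | j < k].

Lemma natf_neq0 n : (0 < n)%N -> n%:R != 0 :> F.
Proof. by move=> n0; move/pcharf0P: charF => ->; rewrite -lt0n. Qed.

Lemma invA_natrK n : (0 < n)%N -> (n%:R^-1 : F)%:A * n%:R = 1 :> V.
Proof.
by move=> n0; rewrite -scalerAl mul1r -scaler_nat scalerA mulVf ?scale1r //
  natf_neq0.
Qed.

Lemma signrMsq (R : pzRingType) (b : bool) (x : R) :
  (-1) ^+ b * ((-1) ^+ b * x) = x.
Proof. by rewrite mulrA -expr2 sqrr_sign mul1r. Qed.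

Lemma sum_perm_const (M : nmodType) n (c : M) : \sum_(s : 'S_n) c = c *+ n`!.
Proof. by rewrite -card_Sn -sumr_const; apply: eq_bigl => s; rewrite inE. Qed.

(** By induction on k. For each s in S_k, translating the sum over S_(k+1) by the lift of s that
    fixes 0 makes the summand independent of s; the resulting k! copies cancel the normalization of
    [wedgeO]. *)
Lemma wedgeseqE k (y x : {ffun 'I_k -> Gen l}) :
  wedgeseq V y x
  = \sum_(s : 'S_k) (-1) ^+ odd_perm s * ([ffun j => x (s j)] == y)%:R.
Proof.
elim: k => [|k IHk] in y x *.
  rewrite (bigD1 1%g) //= big1 ?addr0 => [|s]; last first.
    by rewrite (_ : s = 1%g) ?eqxx //; apply/permP; case.
  rewrite odd_perm1 mul1r (_ : _ == _) //; apply/eqP/ffunP; case=> //.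
rewrite /= /wedgeO.
transitivity ((((1`! * k`!)%:R^-1 : F)%:A : V) * \sum_(s : 'S_k)
    \sum_(t : 'S_k.+1) (-1) ^+ odd_perm t * ([ffun j => x (t j)] == y)%:R).
  congr (_ * _); under eq_bigr => t _ do rewrite IHk mulr_sumr.
  rewrite exchange_big; apply: eq_bigr => s _ /=.
  rewrite [RHS](reindex_inj (mulgI (lift_perm ord0 ord0 s))).
  apply: eq_bigr => t _.
  rewrite odd_permM odd_lift_perm addbb addFb signr_addb.
  have -> : ([ffun j => x ((lift_perm ord0 ord0 s * t)%g j)] == y)%:R
      = genO V (y ord0) [ffun j => x (t (lshift k j))]
        * ([ffun j => [ffun j0 => x (t (rshift 1 j0))] (s j)]
             == [ffun j => y (lift ord0 j)])%:R :> V.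
    rewrite /genO !ffunE (_ : lshift k ord0 = ord0); last exact: val_inj.
    have [E0|ne] := eqVneq (x (t ord0)) (y ord0); last first.
      rewrite mul0r; case: eqP => // /ffunP/(_ ord0)/eqP.
      by rewrite ffunE permM lift_perm_id (negbTE ne).
    rewrite mul1r; congr (nat_of_bool _)%:R; apply/eqP/eqP => /ffunP E.
      apply/ffunP => j; have := E (lift ord0 j).
      by rewrite !ffunE permM lift_perm_lift => <-; congr (x (t _)); apply: val_inj.
    apply/ffunP => j; rewrite ffunE permM.
    case: (unliftP ord0 j) => [j' ->|->]; last by rewrite lift_perm_id.
    rewrite lift_perm_lift; have := E j'.
    by rewrite !ffunE => <-; congr (x (t _)); apply: val_inj.
  by rewrite mulrACA [(-1) ^+ t * _]mulrC.
rewrite sum_perm_const -[_ *+ k`!]mulr_natl mulrA mul1n invA_natrK ?mul1r //.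
exact: fact_gt0.
Qed.

Lemma PhiE k (g : GammaT l V k) : alternating (coefG g) -> Phi g = coefG g.
Proof.
move=> altg; apply: functional_extensionality => x; rewrite /Phi.
transitivity (((k`!%:R^-1 : F)%:A : V) * \sum_(s : 'S_k)
    (-1) ^+ odd_perm s * coefG g [ffun j => x (s j)]).
  congr (_ * _); under eq_bigr => i _.
    under eq_bigr => m _ do rewrite wedgeseqE mulr_sumr.
    rewrite exchange_big; over.
  rewrite exchange_big; apply: eq_bigr => s _ /=.
  set xs := [ffun j => x (s j)].
  under eq_bigr => i _ do under eq_bigr => m _ do rewrite mulrCA.
  under eq_bigr => i _ do rewrite -mulr_sumr.
  rewrite -mulr_sumr; congr (_ * _).
  (* The indicator of [xs] forces the indices i to be its first components and the exponents m its
     second components. *)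
  rewrite (bigD1 [ffun j => (xs j).1]) //= [X in _ + X]big1 ?addr0; last first.
    move=> i ne; rewrite big1 // => m _; case: eqP => [E|_]; last by rewrite mulr0.
    by case/eqP: ne; apply/ffunP => j; rewrite E !ffunE.
  rewrite (@sum_msuppE _ _ _ _ [multinom (xs j).2 | j < k]).
    rewrite /coefG; congr (_ @_ _); congr (g _).
    by apply/ffunP => j; rewrite !ffunE.
  move=> m; congr (nat_of_bool _)%:R; apply/eqP/eqP => [E|->].
    by apply/mnmP => j; rewrite mnmE E !ffunE.
  by apply/ffunP => j; rewrite /xs !ffunE mnmE ffunE -surjective_pairing.
under eq_bigr => s _ do rewrite altg signrMsq.
rewrite sum_perm_const -[coefG g x *+ _]mulr_natl mulrA invA_natrK ?mul1r //.
exact: fact_gt0.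
Qed.

Lemma coefG_alternating k (g : GammaT l V k) :
  isGamma g -> alternating (coefG g).
Proof.
case=> _ _ _ skew s x; rewrite /coefG.
rewrite -[RHS]mcoeffZ -skew mcoeff_perm; congr (_ @_ _).
  by apply/mnmP => j; rewrite !mnmE ffunE.
by congr (g _); apply/ffunP => j; rewrite !ffunE.
Qed.

End PhiCoefficients.

(** * The operations on forms preserve alternation and agree with those on cochains *)

Section Operations.
Variables (F : fieldType) (l : nat) (V : comAlgType F).

(** Deleting r from the source and s(r) from the target leaves a permutation t, with sign(s) =
    (-1)^(r + s(r)) sign(t). This is the sign bookkeeping behind the alternation of [deltaO]. *)
Lemma lift_perm_of n (s : 'S_n.+1) (r : 'I_n.+1) :
  exists t : 'S_n, s = lift_perm r (s r) t.
Proof.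
have ne k : s r != s (lift r k) by rewrite (inj_eq perm_inj) neq_lift.
pose f k := odflt k (unlift (s r) (s (lift r k))).
have fE k : lift (s r) (f k) = s (lift r k).
  by rewrite /f; case: (unlift_some (ne k)) => j -> ->.
have f_inj : injective f.
  move=> i j eqf; apply: (@lift_inj _ r); apply: (@perm_inj _ s).
  by rewrite -!fE eqf.
exists (perm f_inj); apply/permP => k.
case: (unliftP r k) => [j ->|->]; last by rewrite lift_perm_id.
by rewrite lift_perm_lift permE fE.
Qed.

Lemma derivation_sign (D : V -> V) (b : bool) x :
  is_Fderivation D -> D ((-1) ^+ b * x) = (-1) ^+ b * D x.
Proof.
case=> _ DZ _; case: b; rewrite /= ?expr1 ?expr0 ?mul1r // !mulN1r.
by rewrite -[in LHS]scaleN1r DZ scaleN1r.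
Qed.

Lemma derivation_additive (D : V -> V) :
  is_Fderivation D -> D 0 = 0 /\ forall x y, D (x + y) = D x + D y.
Proof. by case=> DD DZ _; split=> //; have := DZ 0 0; rewrite !scale0r. Qed.

Lemma wedgeO_alternating h k (al : OmegaT l V h) (be : OmegaT l V k) :
  alternating (wedgeO al be).
Proof.
move=> s x; rewrite /wedgeO mulrCA; congr (_ * _).
rewrite mulr_sumr (reindex_inj (mulIg s^-1)%g) /=; apply: eq_bigr => t _.
rewrite odd_permM odd_permV signr_addb [_ * (-1) ^+ s]mulrC -!mulrA.
do 3 congr (_ * _); [congr (al _)|congr (be _)];
  by apply/ffunP => j; rewrite !ffunE permM permKV.
Qed.

Lemma deltaO_alternating pd k (w : OmegaT l V k) :
  (forall i n, is_Fderivation (pd i n)) ->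
  alternating w -> alternating (deltaO pd w).
Proof.
move=> pdD altw s x; rewrite /deltaO mulr_sumr.
rewrite [RHS](reindex_inj (@perm_inj _ s)) /=; apply: eq_bigr => r _.
have [t st] := lift_perm_of s r.
have -> : [ffun j => [ffun j0 => x (s j0)] (lift r j)]
    = [ffun j => [ffun j0 => x (lift (s r) j0)] (t j)].
  by apply/ffunP => j; rewrite !ffunE {1}st lift_perm_lift.
rewrite altw derivation_sign // ffunE mulrA [in RHS]mulrA; congr (_ * _).
have -> : odd_perm s = odd r (+) odd (s r) (+) odd_perm t.
  by rewrite {1}st odd_lift_perm.
rewrite !signr_addb !signr_odd mulrAC; congr (_ * _).
by rewrite -mulrA -exprD addnn -[(-1) ^+ _.*2]signr_odd odd_double mulr1.
Qed.

Lemma partialO_alternating d k (w : OmegaT l V k) :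
  is_Fderivation d -> alternating w -> alternating (partialO d w).
Proof.
move=> dD altw s x; rewrite /partialO altw derivation_sign // mulrDr; congr (_ + _).
rewrite mulr_sumr [RHS](reindex_inj (@perm_inj _ s)) /=; apply: eq_bigr => r _.
rewrite ffunE; case: (x (s r)) => i [|n] /=; first by rewrite mulr0.
rewrite -altw; congr (w _); apply/ffunP => j.
by rewrite !ffunE (inj_eq perm_inj).
Qed.

Lemma isOmega_bound k (w : OmegaT l V k.+1) : isOmega w ->
  exists N, forall i x n, (N <= n)%N -> w (consf (i, n) x) = 0.
Proof.
by case=> _ [N w0]; exists N => i x n le_n; apply: (w0 _ ord0);
  rewrite ffunE unlift_none.
Qed.

Lemma iotaO_alternating (P : 'I_l -> nat -> V) k (w : OmegaT l V k.+1) :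
  isOmega w -> alternating (iotaO P w).
Proof.
move=> wO s x; have [altw _] := wO; have [N w0] := isOmega_bound wO.
rewrite /iotaO mulr_sumr; apply: eq_bigr => i _.
rewrite !(@fsumE _ _ N) => [|n|n]; try by move/w0 ->; rewrite mulr0.
rewrite mulr_sumr; apply: eq_bigr => n _; rewrite mulrCA; congr (_ * _).
rewrite -[odd_perm s]addFb -(addbb (odd (@ord0 k))) -odd_lift_perm -altw.
congr (w _); apply/ffunP => j; rewrite !ffunE.
case: (unliftP ord0 j) => [j' ->|->].
  by rewrite lift_perm_lift liftK ffunE.
by rewrite lift_perm_id unlift_none.
Qed.

(** [coefmap] only runs over the support, so outside it the formula rests on [D 0 = 0]. *)
Lemma mcoeff_coefmap n (D : V -> V) (P : {mpoly V[n]}) m :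
  D 0 = 0 -> (coefmap D P)@_m = D P@_m.
Proof.
move=> D0; rewrite /coefmap raddf_sum /=.
have [mP|mP] := boolP (m \in msupp P).
  rewrite (bigD1_seq m) ?msupp_uniq //= big1 ?addr0 => [|m' /negbTE ne].
    by rewrite mcoeffZ mcoeffX eqxx mulr1.
  by rewrite mcoeffZ mcoeffX ne mulr0.
rewrite (memN_msupp_eq0 mP) D0 big_seq big1 // => m' m'P.
rewrite mcoeffZ mcoeffX; case: eqP => [E|_]; last by rewrite mulr0.
by rewrite -E m'P in mP.
Qed.

Lemma coefmap_lift n (D : V -> V) (r : 'I_n.+1) (P : {mpoly V[n]}) : D 0 = 0 ->
  coefmap D (comp_mpoly [tuple 'X_(lift r j) | j < n] P)
  = comp_mpoly [tuple 'X_(lift r j) | j < n] (coefmap D P).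
Proof.
move=> D0; apply/mpolyP => m; rewrite mcoeff_coefmap //.
have := mcoeff_lift r 0 P m; rewrite expr0 mul1r => ->.
have := mcoeff_lift r 0 (coefmap D P) m; rewrite expr0 mul1r => ->.
by rewrite mcoeff_coefmap //; case: eqP; rewrite ?mul1r ?mul0r.
Qed.

Lemma coefmap_perm n (D : V -> V) (s : 'S_n) (P : {mpoly V[n]}) : D 0 = 0 ->
  coefmap D (comp_mpoly [tuple 'X_(s j) | j < n] P)
  = comp_mpoly [tuple 'X_(s j) | j < n] (coefmap D P).
Proof.
move=> D0; apply/mpolyP => m.
by rewrite mcoeff_coefmap // !mcoeff_perm mcoeff_coefmap.
Qed.

Lemma actA_uA (pd : 'I_l -> nat -> V -> V) k i (r : 'I_k) (P : {mpoly V[k]}) :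
  actA pd (uA F i) r P = fsum (fun n => 'X_r ^+ n * coefmap (pd i n) P).
Proof.
rewrite /actA (bigD1 i) //= big1 ?addr0 => [|j /negbTE ne].
  rewrite mxE !eqxx map_polyE polyseq1 horner_Poly /=.
  by rewrite mul0r add0r scale1r mpolyC1 mul1r.
by rewrite mxE eqxx ne map_poly0 horner0 mul0r.
Qed.

Lemma coefG_delta d pd k (g : GammaT l V k) x :
  diff_alg d pd -> coefG (deltaG pd g) x = deltaO pd (coefG g) x.
Proof.
case=> [[_ pdD] _ _ _ fin]; rewrite /coefG /deltaG /deltaO raddf_sum /=.
apply: eq_bigr => r _; rewrite mcoeffZ; congr (_ * _).
rewrite ffunE actA_uA; set i := (x r).1.
have -> : [ffun j => [ffun j0 => uA F (x j0).1] (lift r j)]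
   = [ffun j => uA F ([ffun j0 => x (lift r j0)] j).1].
  by apply/ffunP => j; rewrite !ffunE.
set G := g _; set m := Multinom _.
(* The axiom bounds the partial derivatives of one element at a time; the finite support of [G]
   makes a common bound possible. *)
have [N pd0] : exists N, forall n p, (N <= n)%N -> p \in msupp G ->
    pd i n G@_p = 0.
  elim: (msupp G) => [|p s [N IH]]; first by exists 0%N.
  have [N' pd0] := fin G@_p; exists (maxn N N') => n q.
  rewrite geq_max => /andP[leN leN']; rewrite inE => /orP[/eqP->|]; first exact: pd0.
  exact: IH.
have pd00 n : pd i n 0 = 0 by case: (derivation_additive (pdD i n)).
(* The maximum keeps the one contributing index, [(x r).2], inside the range of summation. *)
rewrite (@fsumE _ _ (maxn N (x r).2.+1)) => [|n]; last first.
  rewrite geq_max => /andP[leN _]; rewrite [coefmap _ _](_ : _ = 0) ?mulr0 //.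
  rewrite coefmap_lift // /coefmap big_seq big1 ?raddf0 // => p pG.
  by rewrite pd0 // scale0r.
rewrite raddf_sum /=.
have lt_r : ((x r).2 < maxn N (x r).2.+1)%N by rewrite leq_max ltnSn orbT.
under eq_bigr => n _ do rewrite coefmap_lift // mcoeff_lift mcoeff_coefmap // mnmE.
rewrite (bigD1 (Ordinal lt_r)) //= eqxx mul1r big1 ?addr0 => [|n /negbTE ne].
  by congr (pd _ _ _@__); apply/mnmP => j; rewrite !mnmE ffunE.
by rewrite (_ : (_ == _) = false) ?mul0r.
Qed.

Lemma coefG_wedge h k (al : GammaT l V h) (be : GammaT l V k) x :
  coefG (wedgeG al be) x = wedgeO (coefG al) (coefG be) x.
Proof.
rewrite /coefG /wedgeG /wedgeO mcoeffZ raddf_sum /=; congr (_ * _).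
apply: eq_bigr => s _; rewrite mcoeffZ -mulrA; congr (_ * _).
rewrite (@mcoeff_shuffle _ _ _ _ (fun j => s (lshift k j)) (fun j => s (rshift h j))).
- congr (_ * _); congr (_@__);
    try (by apply/mnmP => j; rewrite !mnmE ffunE);
    by congr (_ _); apply/ffunP => j; rewrite !ffunE.
- by move=> i j /perm_inj/lshift_inj.
- by move=> i j /perm_inj/rshift_inj.
- by move=> i j; rewrite (inj_eq perm_inj) eq_lrshift.
move=> y; rewrite -(permKV s y); case: (split_ordP (s^-1 y)%g) => j ->.
  by left; exists j.
by right; exists j.
Qed.

(** Multiplication by lambda_j shifts the j-th exponent by one, which is the coefficient form of
    sending du^(n) to du^(n+1); exponent 0 receives nothing on either side. *)
Lemma coefG_partial d k (g : GammaT l V k) x :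
  is_Fderivation d -> coefG (partialG d g) x = partialO d (coefG g) x.
Proof.
move=> dD; have [d0 _] := derivation_additive dD.
rewrite /coefG /partialG /partialO mcoeffD mcoeff_coefmap //; congr (_ + _).
rewrite mulr_suml raddf_sum /=; apply: eq_bigr => j _.
rewrite mcoeff_XU mnmE; case E: (x j) => [i [|n]] //=.
congr (_@__).
  apply/mnmP => j'; rewrite mnmBE mnm1E !mnmE ffunE eq_sym.
  by case: eqP => [->|_]; rewrite ?E ?subn0 ?subn1.
congr (g _); apply/ffunP => j'; rewrite !ffunE.
by case: eqP => [->|]; rewrite ?E.
Qed.

Lemma leq_mnm_mdeg n (m : 'X_{1..n}) i : (m i <= mdeg m)%N.
Proof. by rewrite mdegE (bigD1 i) //= leq_addr. Qed.

Hypothesis charF : [pchar F] =i pred0.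

(** The n! of the pairing cancels the 1/n! in P_i(x), by characteristic 0. What remains selects the
    monomials of first exponent n. *)
Lemma coefG_iota (P : 'I_l -> nat -> V) k (g : GammaT l V k.+1) x :
  coefG (iotaG P g) x = iotaO P (coefG g) x.
Proof.
rewrite /coefG /iotaG /iotaO raddf_sum /=; apply: eq_bigr => i _.
set G := g _; set mx := Multinom _.
have consE n : [ffun j => uA F ((consf (i, n) x) j).1]
    = consf (uA F i) [ffun j => uA F (x j).1].
  by apply/ffunP => j; rewrite !ffunE; case: unliftP => *; rewrite ?ffunE.
have mE (n : nat) (m : 'X_{1..k.+1}) :
    (m == [multinom ((consf (i, n) x) j).2 | j < k.+1])
    = (m ord0 == n) && (mtail m == mx).
  apply/eqP/andP => [->|[/eqP m0 /eqP mt]].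
    rewrite mnmE ffunE unlift_none /=; split=> //.
    by apply/eqP/mnmP => j; rewrite !mnmE ffunE liftK.
  apply/mnmP => j; rewrite mnmE ffunE; case: unliftP => [j'|] -> //.
  by have /mnmP/(_ j') := mt; rewrite !mnmE.
rewrite (@fsumE _ _ (msize G)) => [|n le_n]; last first.
  rewrite consE -/G memN_msupp_eq0 ?mulr0 // msize_mdeg_ge //.
  apply: leq_trans le_n _; apply: leq_trans (leq_mnm_mdeg _ ord0).
  by rewrite mnmE ffunE unlift_none.
under [RHS]eq_bigr => n _.
  rewrite consE -/G.
  rewrite -(@sum_msuppE _ _ G (fun m => ((m ord0 == n) && (mtail m == mx))%:R)); last first.
    by move=> m; rewrite mE.
  rewrite mulr_sumr; over.
rewrite [RHS]exchange_big raddf_sum /= big_seq [RHS]big_seq; apply: eq_bigr => m mG.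
have lt_m : (m ord0 < msize G)%N.
  by apply: leq_ltn_trans (leq_mnm_mdeg _ _) (msize_mdeg_lt mG).
rewrite (bigD1 (Ordinal lt_m)) //= eqxx /= big1 ?addr0 => [|n ne]; last first.
  rewrite (_ : (_ == _) = false) ?mulr0 //; apply/negbTE.
  by apply: contra ne => /eqP E; apply/eqP/val_inj.
rewrite mcoeffZ mcoeffX [RHS]mulrA; congr (_ * _).
rewrite -scalerAl mulrCA mulr_natl -scaler_nat scalerA.
by rewrite mulVf ?scale1r // natf_neq0 ?fact_gt0.
Qed.

End Operations.

(** * Injectivity and surjectivity of the passage to coefficients *)

Section Bijectivity.
Variables (F : fieldType) (l : nat) (V : comAlgType F).

Lemma upd_id (T : Type) k (a : {ffun 'I_k -> T}) r : upd a r (a r) = a.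
Proof. by apply/ffunP => j; rewrite ffunE; case: eqP => [->|]. Qed.

Lemma upd_upd (T : Type) k (a : {ffun 'I_k -> T}) r x y :
  upd (upd a r x) r y = upd a r y.
Proof. by apply/ffunP => j; rewrite !ffunE; case: eqP. Qed.

Lemma eq_from_coefG k (g1 g2 : GammaT l V k) :
  isGamma g1 -> isGamma g2 -> coefG g1 =1 coefG g2 -> g1 =1 g2.
Proof.
move=> g1G g2G eq_g.
have base (i : {ffun 'I_k -> 'I_l}) :
    g1 [ffun j => uA F (i j)] = g2 [ffun j => uA F (i j)].
  apply/mpolyP => m; have := eq_g [ffun j => (i j, m j)]; rewrite /coefG.
  rewrite (_ : [ffun j => uA F ([ffun j0 => (i j0, m j0)] j).1]
             = [ffun j => uA F (i j)]); last by apply/ffunP => j; rewrite !ffunE.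
  by rewrite (_ : Multinom _ = m) //; apply/mnmP => j; rewrite !mnmE ffunE.
(* [t] counts the leading slots with arbitrary entries; the remaining slots hold generators. *)
suff H t : (t <= k)%N -> forall a : {ffun 'I_k -> LCA F l},
    (forall j : 'I_k, (t <= j)%N -> exists i, a j = uA F i) -> g1 a = g2 a.
  by move=> a; apply: (H k) => // j; rewrite leqNgt ltn_ord.
elim: t => [|t IHt] le_tk a aE.
  have /fin_all_exists[f fE] j : exists i, a j = uA F i by apply: aE.
  rewrite (_ : a = [ffun j => uA F ([ffun j => f j] j)]) ?base //.
  by apply/ffunP => j; rewrite !ffunE.
have [r IHr] : exists r : 'I_k, forall i,
    g1 (upd a r (uA F i)) = g2 (upd a r (uA F i)).
  exists (Ordinal le_tk) => i; apply: IHt => [|j le_tj]; first exact: ltnW.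
  rewrite ffunE; case: eqP => [_|ne]; first by exists i.
  apply: aE; rewrite ltn_neqAle le_tj andbT.
  by apply/eqP => E; apply: ne; apply: val_inj; rewrite /= E.
have [D1 Z1 d1 _] := g1G; have [D2 Z2 d2 _] := g2G.
(* The values of slot [r] on which the cochains agree contain the u_i and are closed under sums,
   scalars and d, hence exhaust A. *)
pose C y := g1 (upd a r y) = g2 (upd a r y).
have CD y z : C y -> C z -> C (y + z) by rewrite /C D1 D2 => -> ->.
have CZ (c : F) y : C y -> C (c%:P *: y) by rewrite /C Z1 Z2 => ->.
have CX y : C y -> C ('X *: y).
  have := d1 (upd a r y) r; have := d2 (upd a r y) r.
  by rewrite !upd_upd /dA !ffunE eqxx /C => -> -> ->.
have C0 : C 0.
  have -> : 0 = (0 : F)%:P *: 0 :> LCA F l by rewrite scaler0.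
  by rewrite /C Z1 Z2 !scale0r.
suff: C (a r) by rewrite /C upd_id.
rewrite (row_sum_delta (a r)); apply: big_ind => // i _.
elim/poly_ind: (a r 0 i) => [|p c Cp]; first by rewrite scale0r.
rewrite scalerDl; apply: CD; last exact: CZ (IHr i).
by rewrite mulrC -scalerA; apply: CX.
Qed.

(* Sesquilinearity in the slot j: p(d) u_i contributes p(-lambda_j).         *)
Definition evalA k (j : 'I_k) (p : {poly F}) : {mpoly V[k]} :=
  (map_poly (@mpolyC k V \o in_alg V) p).[- 'X_j].

(** The lambda-polynomial that the cochain must take as its value on (u_{i_1}, .., u_{i_k}); [N]
    truncates the exponents. *)
Definition symbol k (w : OmegaT l V k) N (i : 'I_k -> 'I_l) : {mpoly V[k]} :=
  \sum_(n : {ffun 'I_k -> 'I_N})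
    w [ffun j => (i j, n j : nat)] *: 'X_[[multinom (n j : nat) | j < k]].

Definition cochain_of k (w : OmegaT l V k) N : GammaT l V k := fun a =>
  \sum_(i : {ffun 'I_k -> 'I_l}) (\prod_j evalA j (a j 0 (i j))) * symbol w N i.

Lemma evalAD k (j : 'I_k) : {morph evalA j : p q / p + q}.
Proof. by move=> p q; rewrite /evalA rmorphD /= hornerD. Qed.

Lemma evalA_C k (j : 'I_k) c p :
  evalA j (c%:P * p) = (c%:A : V) *: evalA j p.
Proof. by rewrite /evalA rmorphM /= map_polyC hornerM hornerC mul_mpolyC. Qed.

Lemma evalA_X k (j : 'I_k) p : evalA j ('X * p) = - ('X_j * evalA j p).
Proof. by rewrite /evalA rmorphM /= map_polyX hornerM hornerX mulNr. Qed.

Lemma evalA_nat k (j : 'I_k) (b : bool) : evalA j b%:R = b%:R.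
Proof. by rewrite /evalA rmorph_nat -polyC_natr hornerC. Qed.

Lemma evalA_perm k (s : 'S_k) (j : 'I_k) p :
  comp_mpoly [tuple 'X_(s j) | j < k] (evalA j p) = evalA (s j) p.
Proof.
rewrite /evalA -horner_map -map_poly_comp rmorphN /= comp_mpolyXU.
rewrite -tnth_nth tnth_mktuple; congr (_.[_]).
by apply: eq_map_poly => c; rewrite /= comp_mpolyC.
Qed.

Lemma mcoeff_symbol k (w : OmegaT l V k) N i m :
  (forall (g : {ffun 'I_k -> Gen l}) (j : 'I_k), (N <= (g j).2)%N -> w g = 0) ->
  (symbol w N i)@_m = w [ffun j => (i j, m j)].
Proof.
move=> w0; rewrite /symbol raddf_sum /=.
have [/forallP ltm|/forallPn[j leN]] := boolP [forall j, (m j < N)%N].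
  rewrite (bigD1 [ffun j => Ordinal (ltm j)]) //= [X in _ + X]big1 ?addr0.
    rewrite mcoeffZ mcoeffX (_ : _ == _) ?mulr1.
      by congr (w _); apply/ffunP => j; rewrite !ffunE.
    by apply/eqP/mnmP => j; rewrite mnmE ffunE.
  move=> n ne; rewrite mcoeffZ mcoeffX; case: eqP => [E|_]; last by rewrite mulr0.
  case/eqP: ne; apply/ffunP => j; rewrite ffunE; apply: val_inj.
  by rewrite /= -E mnmE.
rewrite -leqNgt in leN; rewrite (w0 _ j) ?ffunE // big1 // => n _.
rewrite mcoeffZ mcoeffX; case: eqP => [E|_]; last by rewrite mulr0.
by move: leN; rewrite -E mnmE leqNgt ltn_ord.
Qed.

Lemma prod_evalA_upd k (a : {ffun 'I_k -> LCA F l}) r x (i : 'I_k -> 'I_l) :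
  \prod_j evalA j (upd a r x j 0 (i j))
  = evalA r (x 0 (i r)) * \prod_(j | j != r) evalA j (a j 0 (i j)).
Proof.
rewrite (bigD1 r) //= ffunE eqxx; congr (_ * _).
by apply: eq_bigr => j /negbTE ne; rewrite ffunE ne.
Qed.

Lemma cochain_of_isGamma k (w : OmegaT l V k) N :
  (forall (g : {ffun 'I_k -> Gen l}) (j : 'I_k), (N <= (g j).2)%N -> w g = 0) ->
  alternating w -> isGamma (cochain_of w N).
Proof.
move=> w0 altw; split.
- move=> a r x y; rewrite /cochain_of -big_split; apply: eq_bigr => i _ /=.
  by rewrite !prod_evalA_upd mxE evalAD !mulrDl.
- move=> a r c x; rewrite /cochain_of scaler_sumr; apply: eq_bigr => i _.
  by rewrite !prod_evalA_upd mxE evalA_C -!scalerAl.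
- move=> a r; rewrite /cochain_of mulr_sumr -sumrN; apply: eq_bigr => i _.
  rewrite -[in RHS](upd_id a r) !prod_evalA_upd mxE evalA_X.
  by rewrite !mulrA !mulNr.
move=> s a; rewrite /cochain_of raddf_sum scaler_sumr /=.
(* Permuting the arguments permutes the index tuples; after this reindexing the [evalA] factors
   match, and alternation of [w] supplies the sign of the [symbol] factor. *)
pose sh (i : {ffun 'I_k -> 'I_l}) := [ffun j => i (s j)].
have shK : injective sh.
  move=> i1 i2 /ffunP E; apply/ffunP => j; rewrite -(permKV s j).
  by have := E (s^-1 j)%g; rewrite !ffunE.
rewrite (reindex_inj shK); apply: eq_bigr => i _ /=.
rewrite rmorphM rmorph_prod scalerAr; congr (_ * _).
  rewrite [RHS](reindex_inj (@perm_inj _ s)); apply: eq_bigr => j _ /=.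
  by rewrite evalA_perm !ffunE.
apply/mpolyP => m; rewrite mcoeff_perm mcoeffZ !mcoeff_symbol // -altw.
by congr (w _); apply/ffunP => j; rewrite !ffunE mnmE.
Qed.

Lemma coefG_cochain_of k (w : OmegaT l V k) N x :
  (forall (g : {ffun 'I_k -> Gen l}) (j : 'I_k), (N <= (g j).2)%N -> w g = 0) ->
  coefG (cochain_of w N) x = w x.
Proof.
move=> w0; rewrite /coefG /cochain_of raddf_sum /=.
rewrite (bigD1 [ffun j => (x j).1]) //= [X in _ + X]big1 ?addr0 => [|i ne].
  rewrite big1 => [|j _]; last by rewrite !ffunE mxE !eqxx (evalA_nat j true).
  rewrite mul1r mcoeff_symbol //; congr (w _); apply/ffunP => j.
  by rewrite !ffunE mnmE -surjective_pairing.
(* On generators [evalA] gives a Kronecker delta, so one mismatched index kills the whole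
   product. *)
have [j nej] : exists j, i j != (x j).1.
  apply/existsP; apply: contraR ne => /existsPn E; apply/eqP/ffunP => j.
  by rewrite ffunE; apply/eqP; rewrite -[_ == _]negbK.
rewrite (bigD1 j) //= ffunE mxE eqxx (negbTE nej) (evalA_nat j false).
by rewrite !mul0r mcoeff0.
Qed.

(** There are finitely many index tuples i, and each value on generators is a polynomial of finite
    degree. *)
Lemma coefG_bounded k (g : GammaT l V k) :
  exists N, forall (x : {ffun 'I_k -> Gen l}) (j : 'I_k), (N <= (x j).2)%N -> coefG g x = 0.
Proof.
pose G (i : {ffun 'I_k -> 'I_l}) := g [ffun j => uA F (i j)].
exists (\max_i msize (G i)) => x j le_x; rewrite /coefG.
have -> : [ffun j => uA F (x j).1] = [ffun j => uA F ([ffun j => (x j).1] j)].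
  by apply/ffunP => j'; rewrite !ffunE.
rewrite memN_msupp_eq0 // msize_mdeg_ge //.
apply: leq_trans (leq_trans (@leq_bigmax _ (fun i => msize (G i)) _) le_x) _.
by rewrite -[(x j).2](mnmE (fun j => (x j).2)) leq_mnm_mdeg.
Qed.

Lemma coefmapD n (D : V -> V) : is_Fderivation D ->
  {morph @coefmap F V n D : P Q / P + Q}.
Proof.
move=> /derivation_additive[D0 DD] P Q; apply/mpolyP => m.
by rewrite mcoeffD !mcoeff_coefmap // mcoeffD DD.
Qed.

Lemma partialG_isGamma d k (g : GammaT l V k) :
  is_Fderivation d -> isGamma g -> isGamma (partialG d g).
Proof.
move=> dD [gD gZ gd gs]; have [d0 _] := derivation_additive dD.
have [_ dZ _] := dD; split; rewrite /partialG.
- by move=> a r x y; rewrite gD coefmapD // mulrDr addrACA.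
- move=> a r c x; rewrite gZ scalerDr -scalerAr; congr (_ + _).
  apply/mpolyP => m; rewrite mcoeffZ !mcoeff_coefmap // mcoeffZ.
  by rewrite -!scalerAl !mul1r dZ.
- move=> a r; rewrite gd mulrDr opprD mulrN mulrCA; congr (_ + _).
  apply/mpolyP => m; rewrite mcoeffN mcoeff_XU !mcoeff_coefmap // mcoeffN mcoeff_XU.
  by rewrite -scaleN1r dZ scaleN1r; case: ifP; rewrite ?d0 ?mcoeff_coefmap.
move=> s a; rewrite raddfD /= rmorphM /= -coefmap_perm // gs raddf_sum /=.
rewrite scalerDr -scalerAr; congr (_ + _).
  apply/mpolyP => m; rewrite mcoeffZ !mcoeff_coefmap // mcoeffZ.
  exact: derivation_sign.
congr (_ *: (_ * _)); rewrite [RHS](reindex_inj (@perm_inj _ s)).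
by apply: eq_bigr => j _; rewrite comp_mpolyXU -tnth_nth tnth_mktuple.
Qed.

End Bijectivity.

(** * Assembly of the isomorphism *)

Unset Implicit Arguments.

Theorem theorem4p6 (F : fieldType) (l : nat) (V : comAlgType F)
    (d : V -> V) (pd : 'I_l -> nat -> V -> V) :
  [pchar F] =i pred0 ->
  diff_alg d pd ->
  [/\
   (* Phi^k maps tilde Gamma^k(A,V) into tilde Omega^k(V) ... *)
   (forall k (g : GammaT l V k), isGamma g -> isOmega (Phi g)),
   (* ... injectively ... *)
   (forall k (g1 g2 : GammaT l V k),
       isGamma g1 -> isGamma g2 -> Phi g1 = Phi g2 -> g1 = g2),
   (* ... and surjectively *)
   (forall k (w : OmegaT l V k), isOmega w ->
       exists g : GammaT l V k, isGamma g /\ Phi g = w),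
   (* F-linearity and unit: Phi is a superalgebra isomorphism *)
   (forall k (g1 g2 : GammaT l V k) (c : F), isGamma g1 -> isGamma g2 ->
       Phi (fun a => g1 a + (c%:A : V) *: g2 a)
       = (fun x => Phi g1 x + (c%:A : V) * Phi g2 x))
   /\ @Phi F l V 0 (fun _ => 1) = (fun _ => 1)
   /\ (forall h k (al : GammaT l V h) (be : GammaT l V k),
       isGamma al -> isGamma be -> Phi (wedgeG al be) = wedgeO (Phi al) (Phi be))
 & (* compatibility with delta, iota_xi (xi <-> Phi_1(xi)), and d *)
   (forall k (g : GammaT l V k), isGamma g ->
       Phi (deltaG pd g) = deltaO pd (Phi g))
   /\ (forall (P : 'I_l -> nat -> V) k (g : GammaT l V k.+1), isGamma g ->
       Phi (iotaG P g) = iotaO P (Phi g))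
   /\ (forall k (g : GammaT l V k), isGamma g ->
       Phi (partialG d g) = partialO d (Phi g))
   /\ (* hence the induced map Gamma^k(A,V) -> Omega^k(V) on the quotients  *)
      (* by the images of d is well defined and bijective                   *)
      (forall k (g : GammaT l V k), isGamma g ->
       (exists g', isGamma g' /\ g = partialG d g')
       <-> (exists w', isOmega w' /\ Phi g = partialO d w'))].

Proof.
move=> charF dV; have [[dD pdD] _ _ _ _] := dV.
have PhiG k (g : GammaT l V k) : isGamma g -> Phi g = coefG g.
  by move=> /coefG_alternating; apply: PhiE.
(* Alternation is checked on the form side, on [w], and carried over to [coefG g], which is all that
   [PhiE] asks of the result of an operation. *)
have PhiOp k (g : GammaT l V k) (w : OmegaT l V k) :
    coefG g =1 w -> alternating w -> Phi g = w.
  by move=> /functional_extensionality <-; apply: PhiE.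
have PhiO k (g : GammaT l V k) : isGamma g -> isOmega (Phi g).
  move=> gG; rewrite PhiG //; split; first exact: coefG_alternating.
  exact: coefG_bounded.
have Phi_inj k (g1 g2 : GammaT l V k) :
    isGamma g1 -> isGamma g2 -> Phi g1 = Phi g2 -> g1 = g2.
  move=> g1G g2G; rewrite !PhiG // => eq_g; apply: functional_extensionality.
  by apply: eq_from_coefG => // x; rewrite eq_g.
have Phi_surj k (w : OmegaT l V k) : isOmega w ->
    exists g : GammaT l V k, isGamma g /\ Phi g = w.
  case=> altw [N w0]; exists (cochain_of w N).
  split; first exact: cochain_of_isGamma.
  by apply: PhiOp => // x; apply: coefG_cochain_of.
have Phi_partial k (g : GammaT l V k) :
    isGamma g -> Phi (partialG d g) = partialO d (Phi g).
  move=> gG; rewrite (PhiG _ g) //; apply: PhiOp => [x|]; first exact: coefG_partial.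
  exact/partialO_alternating/coefG_alternating.
split=> //; [split; [|split]|split; [|split; [|split]]] => //.
- move=> k g1 g2 c g1G g2G; rewrite (PhiG _ g1) // (PhiG _ g2) //; apply: PhiOp => [x|s x].
    by rewrite /coefG mcoeffD mcoeffZ.
  by rewrite !coefG_alternating // mulrDr mulrCA.
- apply: PhiOp => [x|s x]; last by rewrite (_ : s = 1%g) ?odd_perm1 ?mulr1 //; apply/permP; case.
  by rewrite /coefG mcoeff1 (_ : _ == _) //; apply/eqP/mnmP; case.
- move=> h k al be alG beG; rewrite (PhiG _ al) // (PhiG _ be) //; apply: PhiOp => [x|].
    exact: coefG_wedge.
  exact: wedgeO_alternating.
- move=> k g gG; rewrite (PhiG _ g) //; apply: PhiOp => [x|].
    exact: coefG_delta dV.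
  exact/deltaO_alternating/coefG_alternating.
- move=> P k g gG; have gO := PhiO _ _ gG; rewrite (PhiG _ g) // in gO *.
  by apply: PhiOp => [x|]; [apply: coefG_iota|apply: iotaO_alternating].
move=> k g gG; split=> [[g' [g'G ->]]|[w' [/Phi_surj[g' [g'G <-]]]]].
  by exists (Phi g'); split; [apply: PhiO|apply: Phi_partial].
(* Now [Phi g] equals [Phi (partialG d g')]; injectivity applies because [partialG d g'] is again a
   cochain. *)
rewrite -Phi_partial // => /Phi_inj -> //; first by exists g'.
exact: partialG_isGamma.
Qed.
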